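(* Let $U$ be a two-qubit unitary acting on a qubit $A$ and a qubit $B$, with KAK parameters $(u_0,u_1,u_2,u_3)\in\mathbb{C}^4$. Then $$\gamma_{\mathrm{LO}}(U)=\gamma_{\mathrm{LOCC}}(U)=1+2\sum_{i\neq j}|u_i|\,|u_j| ,$$ where the sum is over all ordered pairs $(i,j)\in\{0,1,2,3\}^2$ with $i\neq j$.
   Context: All Hilbert spaces are finite-dimensional. $\mathrm{CPTP}(X)$ is the set of completely positive trace-preserving maps on system $X$. KAK parameters: every two-qubit unitary $U$ on $A\otimes B$ can be written as $U=(V_1\otimes V_2)\big(\sum_{k=0}^3 u_k\,\sigma_k\otimes\sigma_k\big)(V_3\otimes V_4)$ with single-qubit unitaries $V_1,\dots,V_4$, $\sigma_0=\mathds{1}$, $\sigma_1,\sigma_2,\sigma_3$ the Pauli matrices $X,Y,Z$, and $u_k\in\mathbb{C}$ with $\sum_k|u_k|^2=1$. The $u_k$ are called the KAK parameters of $U$. Local operations: $\mathcal{N}(X)=\{\mathcal{A}^+-\mathcal{A}^-:\ \mathcal{A}^\pm \text{ completely positive},\ \mathcal{A}^++\mathcal{A}^-\in\mathrm{CPTP}(X)\}$ and $\mathrm{LO}(A,B)=\{\mathcal{F}_A\otimes\mathcal{F}_B:\ \mathcal{F}_A\in\mathcal{N}(A),\ \mathcal{F}_B\in\mathcal{N}(B)\}$. LOCC: an instrument is a finite family $(\mathcal{E}_i)$ of completely positive maps whose sum is trace preserving. A one-way local instrument from $A$ has the form $(\mathcal{E}_i\otimes\mathcal{T}_i)_i$ with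 $(\mathcal{E}_i)$ an instrument on $A$ and each $\mathcal{T}_i$ CPTP on $B$ (analogously from $B$). An LOCC instrument is obtained by finitely many rounds, in each of which a one-way local instrument (from $A$ or from $B$, possibly changing the local finite dimensions) is applied that may depend on all previous outcomes, followed by coarse-graining (summing) of outcomes. $\mathrm{LOCC}(A,B)$ is the set of maps $\sum_i s_i\mathcal{E}_i$ on $AB$ with $(\mathcal{E}_i)$ an LOCC instrument and $s_i\in\{+1,-1\}$. $\gamma$-factor: for a linear map $\mathcal{E}$ on $AB$ and $S\in\{\mathrm{LO}(A,B),\mathrm{LOCC}(A,B)\}$, $\gamma_S(\mathcal{E})=\min\{\sum_{i=1}^m|a_i| : \mathcal{E}=\sum_{i=1}^m a_i\mathcal{F}_i,\ m\ge1,\ \mathcal{F}_i\in S,\ a_i\in\mathbb{R}\}$. For a unitary $U$, $\gamma_S(U)$ means $\gamma_S$ of the channel $\rho\mapsto U\rho U^\dagger$. *)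

(* Defs.v *)
From HB Require Import structures.
From mathcomp Require Import all_boot all_order all_algebra.
From mathcomp Require Import complex mxtens reals.

Set Implicit Arguments.
Unset Strict Implicit.
Unset Printing Implicit Defensive.

Import Order.TTheory GRing.Theory Num.Theory.
Export ComplexField.Normc(normc).

Local Open Scope ring_scope.
Local Open Scope complex_scope.
Local Open Scope sesquilinear_scope.

(* Linear maps from operators on a Hilbert space of dimension m to operators
   on a Hilbert space of dimension n. A bipartite system is a space of
   dimension dA * dB, identified with the tensor product by [mxtens_index]. *)
Notation supermap R m n := 'Hom('M[R[i]]_m, 'M[R[i]]_n).

(* In the order of R[i], 0 <= z says that z is real and nonnegative, so this
   also forces X to be Hermitian. *)
Definition psdmx (R : realType) (n : nat) (X : 'M[R[i]]_n) : Prop :=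
  forall v : 'cV[R[i]]_n, 0 <= (v ^t* *m X *m v) 0 0.

(* X is expanded in the basis of the E_ij (x) E_kl; see [supertensE]. *)
Definition supertens_fun (R : realType) (m n p q : nat)
    (f : supermap R m n) (g : supermap R p q) (X : 'M[R[i]]_(m * p)) :
    'M[R[i]]_(n * q) :=
  \sum_i \sum_j \sum_k \sum_l
    X (mxtens_index (i, k)) (mxtens_index (j, l)) *:
      (f (delta_mx i j) *t g (delta_mx k l)).

Definition supertens (R : realType) (m n p q : nat)
    (f : supermap R m n) (g : supermap R p q) : supermap R (m * p) (n * q) :=
  linfun (supertens_fun f g).

Lemma supertens_fun_linear (R : realType) (m n p q : nat)
    (f : supermap R m n) (g : supermap R p q) : linear (supertens_fun f g).
Proof.
move=> a X Y; rewrite /supertens_fun.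
do 4![rewrite scaler_sumr -big_split; apply: eq_bigr => ? _ /=].
by rewrite !mxE scalerDl scalerA.
Qed.

HB.instance Definition _ (R : realType) (m n p q : nat)
    (f : supermap R m n) (g : supermap R p q) :=
  GRing.isLinear.Build R[i] 'M[R[i]]_(m * p) 'M[R[i]]_(n * q) *:%R
    (supertens_fun f g) (supertens_fun_linear f g).

Lemma supertensE (R : realType) (m n p q : nat)
    (f : supermap R m n) (g : supermap R p q)
    (X : 'M[R[i]]_m) (Y : 'M[R[i]]_p) :
  supertens f g (X *t Y) = f X *t g Y.
Proof.
rewrite lfunE /= /supertens_fun.
rewrite [in RHS](matrix_sum_delta X) [in RHS](matrix_sum_delta Y).
rewrite !linear_sum /= /tensmx; apply/matrixP => r s.
rewrite [RHS]mxE !summxE mulr_suml; apply: eq_bigr => i _.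
rewrite linear_sum !summxE mulr_suml; apply: eq_bigr => j _.
rewrite mulr_sumr summxE; apply: eq_bigr => k _.
rewrite linear_sum !summxE mulr_sumr; apply: eq_bigr => l _.
by rewrite !linearZ !mxE !mxtens_indexK /= mulrACA.
Qed.

Definition completely_positive (R : realType) (m n : nat)
    (f : supermap R m n) : Prop :=
  forall (k : nat) (X : 'M[R[i]]_(k * m)), psdmx X ->
    psdmx (supertens (\1%VF : supermap R k k) f X).

Definition trace_preserving (R : realType) (m n : nat)
    (f : supermap R m n) : Prop :=
  forall X : 'M[R[i]]_m, \tr (f X) = \tr X.

Definition cptp (R : realType) (m n : nat) (f : supermap R m n) : Prop :=
  completely_positive f /\ trace_preserving f.

(* The set N(X). *)
Definition signed_op (R : realType) (n : nat) (f : supermap R n n) : Prop :=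
  exists fp fm : supermap R n n,
    [/\ completely_positive fp, completely_positive fm,
        cptp (fp + fm) & f = fp - fm].

Definition LO (R : realType) (dA dB : nat)
    (f : supermap R (dA * dB) (dA * dB)) : Prop :=
  exists (fA : supermap R dA dA) (fB : supermap R dB dB),
    [/\ signed_op fA, signed_op fB & f = supertens fA fB].

Definition instrument (R : realType) (m n : nat) (I : finType)
    (E : I -> supermap R m n) : Prop :=
  (forall i, completely_positive (E i)) /\ trace_preserving (\sum_i E i).

Definition one_way_from_A (R : realType) (dA dB eA eB : nat) (I : finType)
    (F : I -> supermap R (dA * dB) (eA * eB)) : Prop :=
  exists (E : I -> supermap R dA eA) (T : I -> supermap R dB eB),
    [/\ instrument E, forall i, cptp (T i) &
        forall i, F i = supertens (E i) (T i)].

Definition one_way_from_B (R : realType) (dA dB eA eB : nat) (I : finType)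
    (F : I -> supermap R (dA * dB) (eA * eB)) : Prop :=
  exists (T : I -> supermap R dA eA) (E : I -> supermap R dB eB),
    [/\ instrument E, forall i, cptp (T i) &
        forall i, F i = supertens (T i) (E i)].

(* Fine-grained protocols from the local dimensions (dA, dB) to (eA, eB): a
   first round F, then for each of its outcomes i a protocol G i for the
   remaining rounds. Everything in G i, intermediate dimensions included, may
   depend on i; its outcomes are the complete histories of outcomes. *)
Inductive locc_protocol (R : realType) (eA eB : nat) :
    forall (dA dB : nat) (I : finType),
      (I -> supermap R (dA * dB) (eA * eB)) -> Prop :=
| locc_stop :
    @locc_protocol R eA eB eA eB unit (fun=> \1%VF)
| locc_round (dA dB cA cB : nat) (I : finType) (J : I -> finType)
    (F : I -> supermap R (dA * dB) (cA * cB))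
    (G : forall i : I, J i -> supermap R (cA * cB) (eA * eB)) :
    one_way_from_A F \/ one_way_from_B F ->
    (forall i : I, @locc_protocol R eA eB cA cB (J i) (G i)) ->
    @locc_protocol R eA eB dA dB {i : I & J i}
      (fun h => (G (tag h) (tagged h) \o F (tag h))%VF).

Definition locc_instrument (R : realType) (dA dB eA eB : nat) (J : finType)
    (E : J -> supermap R (dA * dB) (eA * eB)) : Prop :=
  exists (I : finType) (F : I -> supermap R (dA * dB) (eA * eB)) (c : I -> J),
    locc_protocol F /\ forall j, E j = \sum_(i | c i == j) F i.

Definition LOCC (R : realType) (dA dB : nat)
    (f : supermap R (dA * dB) (dA * dB)) : Prop :=
  exists (I : finType) (E : I -> supermap R (dA * dB) (dA * dB))
         (s : I -> bool),
    locc_instrument E /\ f = \sum_i (-1) ^+ s i *: E i.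

Definition decomposition_cost (R : realType) (n : nat)
    (S : supermap R n n -> Prop) (E : supermap R n n) (c : R) : Prop :=
  exists (m : nat) (a : 'I_m -> R) (F : 'I_m -> supermap R n n),
    [/\ (0 < m)%N, forall i, S (F i),
        E = \sum_(i < m) (a i)%:C *: F i & c = \sum_(i < m) `|a i|].

(* gamma_S(E) = g: the minimum defining gamma_S(E) is attained and equals g. *)
Definition is_gamma (R : realType) (n : nat)
    (S : supermap R n n -> Prop) (E : supermap R n n) (g : R) : Prop :=
  decomposition_cost S E g /\ forall c, decomposition_cost S E c -> g <= c.

Definition unitary_channel (R : realType) (n : nat) (U : 'M[R[i]]_n) :
    supermap R n n :=
  linfun (mulmxr (U ^t*) \o mulmx U).

Definition pauli (R : realType) (k : 'I_4) : 'M[R[i]]_2 :=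
  let mx2 (s : seq (seq R[i])) := \matrix_(i, j) nth 0 (nth [::] s i) j in
  match val k with
  | 0 => mx2 [:: [:: 1; 0]; [:: 0; 1]]
  | 1 => mx2 [:: [:: 0; 1]; [:: 1; 0]]
  | 2 => mx2 [:: [:: 0; - 'i]; [:: 'i; 0]]
  | _ => mx2 [:: [:: 1; 0]; [:: 0; -1]]
  end.

Definition kak_parameters (R : realType) (U : 'M[R[i]]_(2 * 2))
    (u : 'I_4 -> R[i]) : Prop :=
  \sum_k normc (u k) ^+ 2 = 1 /\
  exists V1 V2 V3 V4 : 'M[R[i]]_2,
    [/\ V1 \is unitarymx, V2 \is unitarymx,
        V3 \is unitarymx, V4 \is unitarymx &
        U = (V1 *t V2) *m (\sum_k u k *: (pauli R k *t pauli R k))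
              *m (V3 *t V4)].

(* Main.v *)
(* A unitary with Schmidt decomposition U = sum_k r_k P_k (x) Q_k (here r_k =
   |u_k|, the phases of the KAK parameters being absorbed into the Q_k) has
   gamma = 2 (sum_k r_k)^2 - 1 for both LO and LOCC.

   Upper bound: put A_kl X = P_k X P_l^*, B_kl X = Q_k X Q_l^*, so that the
   channel of U is the sum of the r_k r_l A_kl (x) B_kl. With
   C = (A_kl + A_lk) / 2 and S = i (A_kl - A_lk) / 2, and C', S' formed likewise
   from B, one has (A_kl (x) B_kl + A_lk (x) B_lk) / 2 = C (x) C' - S (x) S'.
   By polarization C and S lie in the set N of signed local operations, and S
   vanishes for k = l, so the cost is
   sum_(k, l) r_k r_l + sum_(k != l) r_k r_l.

   Lower bound: let J be the normalized Choi state and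
   Omega = sum_k |P_k>> (x) |Q_k>>, with |P_k>> and |Q_k>> the unit vectors along
   P_k and Q_k. For a product of completely
   positive maps 0 <= <Omega|J|Omega> <= tr J, hence the functional
   2 <Omega|J|Omega> - tr J is at most 1 in absolute value on LOCC, all of whose
   elements are signed sums of such products; at U it equals
   2 (sum_k r_k)^2 - 1. *)

Require Import Defs.
From mathcomp Require Import all_boot all_order all_algebra.
From mathcomp Require Import complex mxtens reals ring.

Set Implicit Arguments.
Unset Strict Implicit.
Unset Printing Implicit Defensive.

Import Order.TTheory GRing.Theory Num.Theory.

Local Open Scope ring_scope.
Local Open Scope complex_scope.
Local Open Scope sesquilinear_scope.

(** * Tensor products and positive matrices *)

Lemma big_mxtens (V : nmodType) (m n : nat) (F : 'I_(m * n) -> V) :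
  \sum_k F k = \sum_i \sum_j F (mxtens_index (i, j)).
Proof.
rewrite pair_big (reindex (@mxtens_index m n)) /=; first by apply: eq_bigr => -[].
by exists (@mxtens_unindex m n) => k _; rewrite ?mxtens_indexK ?mxtens_unindexK.
Qed.

Lemma mxtrace_tens (R : comPzRingType) (m n : nat) (A : 'M[R]_m) (B : 'M[R]_n) :
  \tr (A *t B) = \tr A * \tr B.
Proof.
rewrite /mxtrace big_mxtens mulr_suml; apply: eq_bigr => i _.
by rewrite mulr_sumr; apply: eq_bigr => j _; rewrite tensmxE.
Qed.

Lemma tensmx_delta (R : comPzRingType) (m n p q : nat)
    (i : 'I_m) (j : 'I_n) (k : 'I_p) (l : 'I_q) :
  delta_mx i j *t delta_mx k l =
  delta_mx (mxtens_index (i, k)) (mxtens_index (j, l)) :> 'M[R]_(m * p, n * q).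
Proof.
apply/matrixP=> r s; case: (mxtens_indexP r) => a b; case: (mxtens_indexP s) => c d.
rewrite tensmxE !mxE !(can_eq (@mxtens_indexK _ _)) !xpair_eqE -natrM mulnb.
by congr ((nat_of_bool _)%:R); rewrite andbACA.
Qed.

Lemma tensmxDl (R : comPzRingType) (m n p q : nat)
    (A A' : 'M[R]_(m, n)) (B : 'M[R]_(p, q)) :
  (A + A') *t B = A *t B + A' *t B.
Proof. by apply/matrixP=> r s; rewrite !mxE mulrDl. Qed.

Lemma tensmxDr (R : comPzRingType) (m n p q : nat)
    (A : 'M[R]_(m, n)) (B B' : 'M[R]_(p, q)) :
  A *t (B + B') = A *t B + A *t B'.
Proof. by apply/matrixP=> r s; rewrite !mxE mulrDr. Qed.

Lemma tensmxZl (R : comPzRingType) (m n p q : nat)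
    (a : R) (A : 'M[R]_(m, n)) (B : 'M[R]_(p, q)) :
  (a *: A) *t B = a *: (A *t B).
Proof. by apply/matrixP=> r s; rewrite !mxE mulrA. Qed.

Lemma tensmxZr (R : comPzRingType) (m n p q : nat)
    (a : R) (A : 'M[R]_(m, n)) (B : 'M[R]_(p, q)) :
  A *t (a *: B) = a *: (A *t B).
Proof. by apply/matrixP=> r s; rewrite !mxE mulrCA. Qed.

Lemma tensmx11 (R : comPzRingType) (m n : nat) :
  1%:M *t 1%:M = 1%:M :> 'M[R]_(m * n).
Proof.
apply/matrixP=> r s; case: (mxtens_indexP r) => i k; case: (mxtens_indexP s) => j l.
by rewrite tensmxE !mxE (can_eq (@mxtens_indexK _ _)) -natrM mulnb.
Qed.

Lemma mul_delta_mxE (R : comPzRingType) (m n p q : nat)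
    (A : 'M[R]_(m, n)) (B : 'M[R]_(p, q)) i j k l :
  (A *m delta_mx i j *m B) k l = A k i * B j l.
Proof.
rewrite mxE (bigD1 j) //= big1 ?addr0 => [|j' /negPf nj].
  by rewrite mxE (bigD1 i) //= big1 ?addr0 => [|i' /negPf ni];
    rewrite !mxE ?eqxx ?mulr1 // ni mulr0.
by rewrite mxE big1 ?mul0r // => i' _; rewrite !mxE nj andbF mulr0.
Qed.

Lemma adjmx_tens (C : numClosedFieldType) (m n p q : nat)
    (A : 'M[C]_(m, n)) (B : 'M[C]_(p, q)) :
  (A *t B) ^t* = A ^t* *t B ^t*.
Proof. by rewrite trmx_tens map_mxT. Qed.

Lemma adjmx_mul (C : numClosedFieldType) (m n p : nat)
    (A : 'M[C]_(m, n)) (B : 'M[C]_(n, p)) :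
  (A *m B) ^t* = B ^t* *m A ^t*.
Proof. by rewrite trmx_mul map_mxM. Qed.

Lemma adjmxD (C : numClosedFieldType) (m n : nat) (A B : 'M[C]_(m, n)) :
  (A + B) ^t* = A ^t* + B ^t*.
Proof. by rewrite linearD map_mxD. Qed.

Lemma adjmxZ (C : numClosedFieldType) (m n : nat) (a : C) (A : 'M[C]_(m, n)) :
  (a *: A) ^t* = a^*%R *: A ^t*.
Proof. by rewrite linearZ map_mxZ. Qed.

Lemma adjmx_sum (C : numClosedFieldType) (m n : nat) (I : finType)
    (A : I -> 'M[C]_(m, n)) :
  (\sum_i A i) ^t* = \sum_i (A i) ^t*.
Proof. by rewrite linear_sum map_mx_sum. Qed.

Lemma adjmx_delta (C : numClosedFieldType) (m n : nat) (i : 'I_m) (j : 'I_n) :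
  (delta_mx i j) ^t* = delta_mx j i :> 'M[C]_(n, m).
Proof. by rewrite trmx_delta map_delta_mx. Qed.

(** Polarization over the complex field: basis vectors kill the diagonal, and [e_i + c e_j] with
    [c = 1] and [c = 'i] makes [Y i j] both opposite and equal to [Y j i]. *)
Lemma quadratic_form_eq0 (C : numClosedFieldType) (n : nat) (Y : 'M[C]_n) :
  (forall v : 'cV[C]_n, (v ^t* *m Y *m v) 0 0 = 0) -> Y = 0.
Proof.
move=> Y0.
have E (i j : 'I_n) : (delta_mx 0 i *m Y *m delta_mx j 0 : 'M_1) 0 0 = Y i j.
  by rewrite -rowE -colE !mxE.
have D i : Y i i = 0 by rewrite -(Y0 (delta_mx i 0)) adjmx_delta E.
have addE (A B : 'M[C]_1) : (A + B) 0 0 = A 0 0 + B 0 0 by rewrite mxE.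
have scaleE a (A : 'M[C]_1) : (a *: A) 0 0 = a * A 0 0 by rewrite mxE.
have Q (c : C) i j : c * Y i j + c^*%R * Y j i = 0.
  rewrite -(Y0 (delta_mx i 0 + c *: delta_mx j 0)).
  rewrite adjmxD adjmxZ !adjmx_delta !mulmxDl !mulmxDr -!scalemxAl -!scalemxAr.
  by rewrite !addE !scaleE !E !D !mulr0 add0r addr0 addrC.
apply/matrixP=> i j; rewrite mxE.
have := Q 1 i j; rewrite conjC1 !mul1r => /eqP; rewrite addr_eq0 => /eqP Yij.
have /eqP := Q 'i%R i j; rewrite conjCi mulNr -mulrBr mulf_eq0 (negPf (neq0Ci _)) /=.
by rewrite Yij -opprD oppr_eq0 -mulr2n mulrn_eq0 /= => /eqP ->; rewrite oppr0.
Qed.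

Lemma psdmxD (R : realType) (n : nat) (X Y : 'M[R[i]]_n) :
  psdmx X -> psdmx Y -> psdmx (X + Y).
Proof.
move=> X0 Y0 v; rewrite mulmxDr mulmxDl mxE.
by apply: addr_ge0; [exact: X0 | exact: Y0].
Qed.

Lemma psdmx_congr (R : realType) (m n : nat) (K : 'M[R[i]]_(n, m)) X :
  psdmx X -> psdmx (K *m X *m K ^t*).
Proof.
move=> X0 v; have := X0 (K ^t* *m v).
by rewrite adjmx_mul trmxCK !mulmxA.
Qed.

(** The quadratic form of [X ^t*] is the conjugate of that of [X], hence equal to it, the values
    being real. *)
Lemma psdmx_herm (R : realType) (n : nat) (X : 'M[R[i]]_n) :
  psdmx X -> X ^t* = X.
Proof.
move=> X0; apply/eqP; rewrite -subr_eq0; apply/eqP/quadratic_form_eq0 => v.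
rewrite mulmxBr mulmxBl mxE [X in _ + X]mxE.
apply/eqP; rewrite subr_eq0; apply/eqP.
rewrite -[RHS](CrealP (ger0_real (X0 v))).
have -> : v ^t* *m X ^t* *m v = (v ^t* *m X *m v) ^t*.
  by rewrite !adjmx_mul trmxCK mulmxA.
by rewrite !mxE.
Qed.

(** Spectral theorem: [X] is [P ^t* D P] with [D] diagonal and nonnegative, and [Y] is the square
    root of [D] times [P]. *)
Lemma psdmx_gram (R : realType) (n : nat) (X : 'M[R[i]]_n) :
  psdmx X -> exists Y : 'M[R[i]]_n, X = Y ^t* *m Y.
Proof.
move=> X0; have /normalmxP/orthomx_spectralP XE : X *m X ^t* = X ^t* *m X.
  by rewrite (psdmx_herm X0).
have U := spectral_unitarymx X; rewrite (invmx_unitary U) in XE.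
move: (spectralmx X) (spectral_diag X) U XE => P d U XE.
have d0 k : 0 <= d 0 k.
  have := X0 (P ^t* *m delta_mx k 0).
  rewrite XE adjmx_mul trmxCK adjmx_delta !mulmxA.
  by rewrite !mulmxtVK // -rowE -colE !mxE eqxx.
exists (diag_mx (map_mx sqrtC d) *m P); rewrite XE adjmx_mul.
rewrite -!mulmxA; congr (_ *m _); rewrite mulmxA; congr (_ *m _).
rewrite tr_diag_mx map_diag_mx mulmx_diag; congr diag_mx.
apply/rowP=> k; rewrite !mxE.
have sd : (sqrtC (d 0 k))^*%R = sqrtC (d 0 k).
  by apply/CrealP; rewrite ger0_real ?sqrtC_ge0.
by rewrite /= sd -expr2 sqrtCK.
Qed.

Lemma CauchySchwarz_sum (C : numClosedFieldType) (n : nat) (x y : 'I_n -> C) :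
  `|\sum_k x k * y k| ^+ 2 <= (\sum_k `|x k| ^+ 2) * (\sum_k `|y k| ^+ 2).
Proof.
(* The sum to be bounded is bilinear, so [y] is conjugated to offset the conjugation in [dotmx]. *)
pose u := \row_k x k; pose v := \row_k (y k)^*%R.
have : `|dotmx u v| ^+ 2 <= dotmx u u * dotmx v v.
  by have [+ _] := CauchySchwarz (@dotmx C n) u v.
rewrite !dotmxE !mxE; congr (_ ^+ 2 <= _ * _).
- by congr `|_|; apply: eq_bigr => k _; rewrite !mxE conjCK.
- by apply: eq_bigr => k _; rewrite !mxE normCK.
- by apply: eq_bigr => k _; rewrite !mxE conjCK normCK mulrC.
Qed.

(** Gram factors [x] and [y] turn the sum of the entries of the Schur product into the sum over [a],
    [b] of [|sum_k x a k * y b k| ^+ 2]. Cauchy-Schwarz on each summand gives the upper bound. *)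
Lemma psdmx_schur_bounds (R : realType) (n : nat) (F G : 'M[R[i]]_n) :
  psdmx F -> psdmx G ->
  0 <= \sum_k \sum_l F k l * G k l <= \tr F * \tr G.
Proof.
move=> /psdmx_gram[x ->] /psdmx_gram[y ->].
have -> : \sum_k \sum_l (x ^t* *m x) k l * (y ^t* *m y) k l
    = \sum_a \sum_b `|\sum_k x a k * y b k| ^+ 2.
  transitivity (\sum_k \sum_l \sum_a \sum_b
      (x a k)^*%R * (y b k)^*%R * (x a l * y b l)).
    apply: eq_bigr => k _; apply: eq_bigr => l _; rewrite !mxE mulr_suml.
    apply: eq_bigr => a _; rewrite mulr_sumr; apply: eq_bigr => b _.
    by rewrite !mxE mulrACA.
  under eq_bigr do rewrite exchange_big /=.
  rewrite exchange_big /=; apply: eq_bigr => a _.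
  under eq_bigr do rewrite exchange_big /=.
  rewrite exchange_big /=; apply: eq_bigr => b _.
  rewrite normCKC rmorph_sum mulr_suml; apply: eq_bigr => k _.
  by rewrite mulr_sumr rmorphM.
have trE (z : 'M[R[i]]_n) : \tr (z ^t* *m z) = \sum_a \sum_k `|z a k| ^+ 2.
  rewrite /mxtrace exchange_big; apply: eq_bigr => k _.
  by rewrite mxE; apply: eq_bigr => a _; rewrite !mxE normCKC.
rewrite !trE; apply/andP; split.
  by do 2![apply: sumr_ge0 => ? _]; rewrite exprn_ge0.
rewrite mulr_suml; apply: ler_sum => a _; rewrite mulr_sumr; apply: ler_sum => b _.
exact: CauchySchwarz_sum.
Qed.

(** * Maps between operator spaces *)

(** Matrix units of the composite space are tensor products of matrix units. *)
Lemma tens_hom_eq (R : realType) (m p q : nat) (f g : supermap R (m * p) q) :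
  (forall X Y, f (X *t Y) = g (X *t Y)) -> f = g.
Proof.
move=> fg; apply/lfunP => X; rewrite [X]matrix_sum_delta !linear_sum.
apply: eq_bigr => r _; rewrite !linear_sum; apply: eq_bigr => s _; rewrite !linearZ /=.
case: (mxtens_indexP r) => i k; case: (mxtens_indexP s) => j l.
by rewrite -tensmx_delta fg.
Qed.

Lemma supertens_comp (R : realType) (m n p m' n' p' : nat)
    (f : supermap R n p) (g : supermap R m n)
    (f' : supermap R n' p') (g' : supermap R m' n') :
  (supertens f f' \o supertens g g')%VF = supertens (f \o g)%VF (f' \o g')%VF.
Proof. by apply: tens_hom_eq => X Y; rewrite comp_lfunE !supertensE !comp_lfunE. Qed.

Lemma supertens_id (R : realType) (m n : nat) :
  supertens (\1%VF : supermap R m m) (\1%VF : supermap R n n) = \1%VF.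
Proof. by apply: tens_hom_eq => X Y; rewrite supertensE !id_lfunE. Qed.

Lemma completely_positive_id (R : realType) (n : nat) :
  completely_positive (\1%VF : supermap R n n).
Proof. by move=> k X X0; rewrite supertens_id id_lfunE. Qed.

Lemma cptp_id (R : realType) (n : nat) : cptp (\1%VF : supermap R n n).
Proof. by split=> [|X]; [exact: completely_positive_id | rewrite id_lfunE]. Qed.

Lemma completely_positive_comp (R : realType) (m n p : nat)
    (f : supermap R n p) (g : supermap R m n) :
  completely_positive f -> completely_positive g -> completely_positive (f \o g)%VF.
Proof.
move=> f0 g0 k X X0; have := f0 k _ (g0 k X X0).
by rewrite -comp_lfunE supertens_comp comp_lfun1l.
Qed.

Section SupertensBilinear.

Variables (R : realType) (m n p q : nat).
Implicit Types (f : supermap R m n) (g : supermap R p q) (a : R[i]).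

Lemma supertensDl f f' g : supertens (f + f') g = supertens f g + supertens f' g.
Proof.
apply: tens_hom_eq => X Y.
rewrite [RHS]add_lfunE [LHS]supertensE add_lfunE tensmxDl.
by congr (_ + _); rewrite [RHS]supertensE.
Qed.

Lemma supertensDr f g g' : supertens f (g + g') = supertens f g + supertens f g'.
Proof.
apply: tens_hom_eq => X Y.
rewrite [RHS]add_lfunE [LHS]supertensE add_lfunE tensmxDr.
by congr (_ + _); rewrite [RHS]supertensE.
Qed.

Lemma supertensZl a f g : supertens (a *: f) g = a *: supertens f g.
Proof.
apply: tens_hom_eq => X Y.
rewrite [RHS]scale_lfunE [LHS]supertensE scale_lfunE tensmxZl.
by congr (_ *: _); rewrite [RHS]supertensE.
Qed.

Lemma supertensZr a f g : supertens f (a *: g) = a *: supertens f g.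
Proof.
apply: tens_hom_eq => X Y.
rewrite [RHS]scale_lfunE [LHS]supertensE scale_lfunE tensmxZr.
by congr (_ *: _); rewrite [RHS]supertensE.
Qed.

Lemma supertensNl f g : supertens (- f) g = - supertens f g.
Proof. by rewrite -scaleN1r supertensZl scaleN1r. Qed.

Lemma supertensNr f g : supertens f (- g) = - supertens f g.
Proof. by rewrite -scaleN1r supertensZr scaleN1r. Qed.

Lemma supertens0l g : supertens (0 : supermap R m n) g = 0.
Proof. by rewrite -(scale0r 0) supertensZl scale0r. Qed.

End SupertensBilinear.

(** With [K] and [L] distinct these are the terms [A_kl] and [B_kl] of the upper bound, in general
    not completely positive; for square [K = L] the map is convertible to [unitary_channel K]. *)
Definition sandwich (R : realType) (m n : nat) (K L : 'M[R[i]]_(n, m)) :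
    supermap R m n :=
  linfun (mulmxr (L ^t*) \o mulmx K).

Lemma sandwichE (R : realType) (m n : nat) (K L : 'M[R[i]]_(n, m)) X :
  sandwich K L X = K *m X *m L ^t*.
Proof. by rewrite lfunE. Qed.

Lemma supertens_sandwich (R : realType) (m n p q : nat)
    (K L : 'M[R[i]]_(n, m)) (K' L' : 'M[R[i]]_(q, p)) :
  supertens (sandwich K L) (sandwich K' L') = sandwich (K *t K') (L *t L').
Proof.
apply: tens_hom_eq => X Y.
by rewrite supertensE !sandwichE adjmx_tens !tensmx_mul.
Qed.

Section SandwichSesquilinear.

Variables (R : realType) (m n : nat).
Implicit Types (K L : 'M[R[i]]_(n, m)) (a : R[i]).

Lemma sandwichDl K K' L : sandwich (K + K') L = sandwich K L + sandwich K' L.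
Proof. by apply/lfunP=> X; rewrite [RHS]add_lfunE !sandwichE !mulmxDl. Qed.

Lemma sandwichDr K L L' : sandwich K (L + L') = sandwich K L + sandwich K L'.
Proof. by apply/lfunP=> X; rewrite [RHS]add_lfunE !sandwichE adjmxD mulmxDr. Qed.

Lemma sandwichZl a K L : sandwich (a *: K) L = a *: sandwich K L.
Proof. by apply/lfunP=> X; rewrite [RHS]scale_lfunE !sandwichE -!scalemxAl. Qed.

Lemma sandwichZr a K L : sandwich K (a *: L) = a^*%R *: sandwich K L.
Proof. by apply/lfunP=> X; rewrite [RHS]scale_lfunE !sandwichE adjmxZ -scalemxAr. Qed.

Lemma sandwich_suml (I : finType) (K : I -> 'M[R[i]]_(n, m)) L :
  sandwich (\sum_i K i) L = \sum_i sandwich (K i) L.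
Proof.
by apply/lfunP=> X; rewrite [RHS]sum_lfunE sandwichE !mulmx_suml;
  apply: eq_bigr => i _; rewrite sandwichE.
Qed.

Lemma sandwich_sumr (I : finType) K (L : I -> 'M[R[i]]_(n, m)) :
  sandwich K (\sum_i L i) = \sum_i sandwich K (L i).
Proof.
by apply/lfunP=> X; rewrite [RHS]sum_lfunE sandwichE adjmx_sum mulmx_sumr;
  apply: eq_bigr => i _; rewrite sandwichE.
Qed.

End SandwichSesquilinear.

(** The identity map is itself a sandwich, so each amplification is a congruence. *)
Lemma completely_positive_sandwich (R : realType) (m n : nat)
    (K : 'M[R[i]]_(n, m)) :
  completely_positive (sandwich K K).
Proof.
move=> k X X0.
have -> : (\1%VF : supermap R k k) = sandwich 1%:M 1%:M.
  by apply/lfunP=> Y; rewrite id_lfunE sandwichE trmx1 map_mx1 mul1mx mulmx1.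
by rewrite supertens_sandwich sandwichE; exact: psdmx_congr.
Qed.

Lemma scale_half_double (F : numFieldType) (V : lmodType F) (v : V) :
  2^-1 *: (v + v) = v.
Proof.
by rewrite -mulr2n -scalerMnr scalerMnl -mulr_natr mulVf ?pnatr_eq0 ?scale1r.
Qed.

Lemma scale_half_add_sub (F : numFieldType) (V : lmodType F) (v w : V) :
  2^-1 *: (v + w) + 2^-1 *: (v - w) = v.
Proof. by rewrite -scalerDr addrACA subrr addr0 scale_half_double. Qed.

Lemma scale_half_sub_sub (F : numFieldType) (V : lmodType F) (v w : V) :
  2^-1 *: (v + w) - 2^-1 *: (v - w) = w.
Proof. by rewrite -scalerBr opprB (addrC w) addrACA subrr add0r scale_half_double. Qed.

(** Expansion of the map with Kraus operator [c P + e Q], for a phase [c] with conjugate [c'] and a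
    sign [e]. *)
Lemma scale_expand_cross (F : comPzRingType) (V : lmodType F) (c c' e : F)
    (pp pq qp qq : V) :
  c * c' = 1 -> e * e = 1 ->
  c *: (c' *: pp + e *: pq) + e *: (c' *: qp + e *: qq) =
  pp + qq + e *: (c *: pq + c' *: qp).
Proof.
move=> cc ee; rewrite !scalerDr !scalerA cc ee !scale1r (mulrC c e).
by rewrite (addrC (_ *: qp)) addrACA.
Qed.

(** The Kraus operators [(c P + Q) / 2] and [(c P - Q) / 2] define two maps. Their difference is the
    required map, and their sum is the average of two unitary channels, hence trace preserving. *)
Lemma signed_op_cross (R : realType) (n : nat) (P Q : 'M[R[i]]_n) (c : R[i]) :
  P \is unitarymx -> Q \is unitarymx -> c * c^*%R = 1 ->
  signed_op (2^-1 *: (c *: sandwich P Q + c^*%R *: sandwich Q P)).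
Proof.
move=> /unitarymxP/mulmx1C UP /unitarymxP/mulmx1C UQ cc.
set S : supermap R n n := sandwich P P + sandwich Q Q.
set X : supermap R n n := c *: sandwich P Q + c^*%R *: sandwich Q P.
have h2 : (2^-1 : R[i])^*%R = 2^-1 by rewrite fmorphV rmorph_nat.
pose K (e : R[i]) := 2^-1 *: (c *: P + e *: Q).
have KE (e : R[i]) : e^*%R = e -> e * e = 1 ->
    sandwich (K e) (K e) = 2^-1 *: (2^-1 *: (S + e *: X)).
  move=> ec ee; rewrite sandwichZl sandwichZr h2; congr (_ *: (_ *: _)).
  rewrite sandwichDl 2!sandwichZl 2!sandwichDr 2!(sandwichZr c) 2!(sandwichZr e) ec.
  exact: scale_expand_cross.
have K1 : sandwich (K 1) (K 1) = 2^-1 *: (2^-1 *: S + 2^-1 *: X).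
  by rewrite (KE _ (conjC1 _) (mulr1 _)) scale1r scalerDr.
have K2 : sandwich (K (-1)) (K (-1)) = 2^-1 *: (2^-1 *: S - 2^-1 *: X).
  have c1 : (-1 : R[i])^*%R = -1 by rewrite rmorphN rmorph1.
  have s1 : -1 * -1 = 1 :> R[i] by rewrite mulrNN mulr1.
  by rewrite (KE _ c1 s1) scaleN1r scalerBr.
exists (sandwich (K 1) (K 1)), (sandwich (K (-1)) (K (-1))).
split; try exact: completely_positive_sandwich.
- have KD : sandwich (K 1) (K 1) + sandwich (K (-1)) (K (-1)) = 2^-1 *: S.
    by rewrite [X in X + _]K1 [X in _ + X]K2; exact: scale_half_add_sub.
  split.
    move=> k Y Y0; rewrite supertensDr add_lfunE.
    by apply: psdmxD; exact: completely_positive_sandwich.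
  move=> Y; rewrite KD scale_lfunE add_lfunE mxtraceZ mxtraceD.
  rewrite 2!sandwichE 2!(mxtrace_mulC _ (_ ^t*)) 2!mulmxA UP UQ mul1mx.
  exact: (@scale_half_double _ (R[i])^o).
- by rewrite [X in X - _]K1 [X in _ - X]K2; apply: esym; exact: scale_half_sub_sub.
Qed.

(** * Choi operators and the dual witness *)

(* The matrix element <<K|J|L>> of the unnormalized Choi operator J of f, where
   |K>> is the matrix K read as a vector. *)
Definition choi_form (R : realType) (m n : nat) (K L : 'M[R[i]]_(n, m))
    (f : supermap R m n) : R[i] :=
  \sum_i \sum_j (K ^t* *m f (delta_mx i j) *m L) i j.

Section ChoiForm.

Variables (R : realType) (m n : nat).
Implicit Types (K L : 'M[R[i]]_(n, m)) (f g : supermap R m n).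

Lemma choi_formD K L f g :
  choi_form K L (f + g) = choi_form K L f + choi_form K L g.
Proof.
rewrite /choi_form -big_split; apply: eq_bigr => i _ /=.
rewrite -big_split; apply: eq_bigr => j _ /=.
by rewrite add_lfunE mulmxDr mulmxDl mxE.
Qed.

Lemma choi_formZ K L a f : choi_form K L (a *: f) = a * choi_form K L f.
Proof.
rewrite /choi_form mulr_sumr; apply: eq_bigr => i _.
rewrite mulr_sumr; apply: eq_bigr => j _.
by rewrite scale_lfunE -scalemxAr -scalemxAl mxE.
Qed.

Lemma choi_form_suml (I : finType) (a : I -> R[i]) (K : I -> 'M[R[i]]_(n, m)) L f :
  choi_form (\sum_k a k *: K k) L f = \sum_k (a k)^*%R * choi_form (K k) L f.
Proof.
under [RHS]eq_bigr do rewrite mulr_sumr.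
rewrite exchange_big; apply: eq_bigr => i _.
under [RHS]eq_bigr do rewrite mulr_sumr.
rewrite exchange_big; apply: eq_bigr => j _.
rewrite adjmx_sum !mulmx_suml summxE; apply: eq_bigr => k _.
by rewrite adjmxZ -!scalemxAl mxE.
Qed.

Lemma choi_form_sumr (I : finType) (b : I -> R[i]) K (L : I -> 'M[R[i]]_(n, m)) f :
  choi_form K (\sum_l b l *: L l) f = \sum_l b l * choi_form K (L l) f.
Proof.
under [RHS]eq_bigr do rewrite mulr_sumr.
rewrite exchange_big; apply: eq_bigr => i _.
under [RHS]eq_bigr do rewrite mulr_sumr.
rewrite exchange_big; apply: eq_bigr => j _.
rewrite mulmx_sumr summxE; apply: eq_bigr => l _.
by rewrite -scalemxAr mxE.
Qed.

(** The form is the quadratic form of the Choi matrix at the vectorization of [K], and the Choi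
    matrix is the image of a positive matrix under an amplification of [f]. *)
Lemma choi_form_ge0 K f : completely_positive f -> 0 <= choi_form K K f.
Proof.
move=> f0.
(* The unnormalized maximally entangled vector on two copies of the input space. *)
pose w : 'cV[R[i]]_(m * m) := \sum_i delta_mx (mxtens_index (i, i)) 0.
pose X := w *m w ^t*.
have X0 : psdmx X.
  move=> v; have -> : v ^t* *m X *m v = (w ^t* *m v) ^t* *m (w ^t* *m v).
    by rewrite adjmx_mul trmxCK !mulmxA.
  by rewrite mxE big_ord1 !mxE -normCKC exprn_ge0.
have XE : X = \sum_i \sum_j delta_mx i j *t delta_mx i j.
  rewrite /X adjmx_sum mulmx_suml; apply: eq_bigr => i _.
  rewrite mulmx_sumr; apply: eq_bigr => j _.
  by rewrite adjmx_delta mul_delta_mx tensmx_delta.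
(* The vector [|K>>], with the input index first, as in the amplification of [f]. *)
pose v : 'cV[R[i]]_(m * n) :=
  \col_r K (mxtens_unindex r).2 (mxtens_unindex r).1.
have vE i a : v (mxtens_index (i, a)) 0 = K a i by rewrite mxE mxtens_indexK.
have := f0 m X X0 v.
pose Z : 'M[R[i]]_(m * n) := \sum_i \sum_j delta_mx i j *t f (delta_mx i j).
have -> : supertens \1%VF f X = Z.
  rewrite XE linear_sum; apply: eq_bigr => i _; rewrite linear_sum.
  by apply: eq_bigr => j _; rewrite [LHS]supertensE id_lfunE.
have ZE i a j b :
    Z (mxtens_index (i, a)) (mxtens_index (j, b)) = f (delta_mx i j) a b.
  rewrite summxE (bigD1 i) //= summxE (bigD1 j) //= tensmxE mxE !eqxx mul1r.
  rewrite !big1 ?addr0 // => [i' /negPf ni|j' /negPf nj].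
    rewrite summxE big1 // => j' _.
    by rewrite tensmxE mxE (eq_sym i) ni mul0r.
  by rewrite tensmxE mxE (eq_sym j) nj andbF mul0r.
rewrite mxE big_mxtens /choi_form exchange_big; congr (0 <= _).
under [RHS]eq_bigr do under eq_bigr do rewrite mxE.
under [RHS]eq_bigr do rewrite exchange_big.
rewrite [RHS]exchange_big /=; apply: eq_bigr => b _.
rewrite [RHS]exchange_big /=; apply: eq_bigr => j _.
rewrite vE mxE big_mxtens mulr_suml; apply: eq_bigr => i _; congr (_ * _).
by rewrite [RHS]mxE; apply: eq_bigr => a _; rewrite ZE !mxE mxtens_indexK.
Qed.

End ChoiForm.

Lemma choi_form_tens (R : realType) (m n p q : nat)
    (K L : 'M[R[i]]_(n, m)) (K' L' : 'M[R[i]]_(q, p))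
    (f : supermap R m n) (g : supermap R p q) :
  choi_form (K *t K') (L *t L') (supertens f g) =
  choi_form K L f * choi_form K' L' g.
Proof.
rewrite /choi_form big_mxtens mulr_suml; apply: eq_bigr => i _.
transitivity (\sum_k \sum_j \sum_l (K ^t* *m f (delta_mx i j) *m L) i j *
    (K' ^t* *m g (delta_mx k l) *m L') k l).
  apply: eq_bigr => k _; rewrite big_mxtens; apply: eq_bigr => j _.
  apply: eq_bigr => l _; rewrite -tensmx_delta adjmx_tens.
  by rewrite [X in _ *m X *m _]supertensE 2!tensmx_mul tensmxE.
rewrite exchange_big mulr_suml; apply: eq_bigr => j _.
rewrite mulr_sumr; apply: eq_bigr => k _.
by rewrite mulr_sumr.
Qed.

(** The Choi operator of [sandwich M N] is [|M>><<N|], so its matrix elements are products of two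
    Hilbert-Schmidt inner products. *)
Lemma choi_form_sandwich (R : realType) (m n : nat) (K L M N : 'M[R[i]]_(n, m)) :
  choi_form K L (sandwich M N) = \tr (K ^t* *m M) * \tr (N ^t* *m L).
Proof.
rewrite /choi_form /mxtrace mulr_suml; apply: eq_bigr => i _.
rewrite mulr_sumr; apply: eq_bigr => j _.
by rewrite sandwichE !mulmxA -(mulmxA (_ *m delta_mx i j)) mul_delta_mxE.
Qed.

(** The squared norm [n] is that of a unitary matrix, so the Pauli matrices qualify unscaled. The
    size of the index type turns orthogonality into completeness. *)
Definition hs_basis (R : realType) (n : nat) (P : 'I_(n * n) -> 'M[R[i]]_n) :=
  forall k l, \tr (P k ^t* *m P l) = n%:R * (k == l)%:R.

(** Orthogonality provides a right inverse, proportional to the adjoint, of the square matrix [B]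
    whose rows are the vectorized [P k]. It is also a left inverse, which is completeness. *)
Lemma hs_basis_complete (R : realType) (n : nat) (P : 'I_(n * n) -> 'M[R[i]]_n) :
  hs_basis P -> forall a i b j,
  \sum_k (P k a i)^*%R * P k b j = n%:R * ((a == b) && (i == j))%:R.
Proof.
move=> hP a i b j.
(* The index [a] witnesses that [n] is positive. *)
have n0 : n%:R != 0 :> R[i] by rewrite pnatr_eq0; case: (n) a => [[]|].
pose B : 'M[R[i]]_(n * n) :=
  \matrix_(k, r) P k (mxtens_unindex r).1 (mxtens_unindex r).2.
have BB : B *m (n%:R^-1 *: B ^t*) = 1%:M.
  rewrite -scalemxAr; apply/matrixP=> k l; rewrite !mxE.
  have -> : \sum_r B k r * B ^t* r l = \tr (P l ^t* *m P k).
    rewrite big_mxtens exchange_big /mxtrace; apply: eq_bigr => c _.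
    rewrite mxE; apply: eq_bigr => d _.
    by rewrite !mxE mxtens_indexK mulrC.
  by rewrite hP mulrA mulVf // mul1r eq_sym.
have := congr1 (fun X : 'M_(n * n) => X (mxtens_index (a, i)) (mxtens_index (b, j)))
  (mulmx1C BB).
rewrite -scalemxAl mxE [RHS]mxE (can_eq (@mxtens_indexK _ _)) xpair_eqE.
move/(canRL (mulKf _)); rewrite invr_eq0 invrK => /(_ n0) <-.
rewrite mxE; apply: eq_bigr => k _.
by rewrite !mxE !mxtens_indexK.
Qed.

(** Completeness of the basis depolarizes [Y] to a multiple of the identity. *)
Lemma hs_basis_twirl (R : realType) (n : nat) (P : 'I_(n * n) -> 'M[R[i]]_n) Y i j :
  hs_basis P ->
  \sum_k (P k ^t* *m Y *m P k) i j = n%:R * (i == j)%:R * \tr Y.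
Proof.
move=> hP.
transitivity (\sum_a \sum_b (\sum_k (P k a i)^*%R * P k b j) * Y a b).
  under [RHS]eq_bigr do under eq_bigr do rewrite mulr_suml.
  under [RHS]eq_bigr do rewrite exchange_big.
  rewrite [RHS]exchange_big; apply: eq_bigr => k _.
  rewrite mxE [RHS]exchange_big; apply: eq_bigr => b _.
  rewrite mxE mulr_suml; apply: eq_bigr => a _.
  by rewrite !mxE mulrAC.
rewrite mulr_sumr; apply: eq_bigr => a _.
rewrite (bigD1 a) //= [X in _ + X]big1 ?addr0 => [|b nab].
  by rewrite (hs_basis_complete hP) eqxx.
by rewrite (hs_basis_complete hP) eq_sym (negPf nab) mulr0 mul0r.
Qed.

(** Up to the factor [sqrt n] the [|P_k>>] are an orthonormal basis, so the sum is [n] times the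
    trace of the Choi operator. *)
Lemma sum_choi_form_basis (R : realType) (n : nat) (P : 'I_(n * n) -> 'M[R[i]]_n)
    (f : supermap R n n) :
  hs_basis P -> \sum_k choi_form (P k) (P k) f = n%:R * \tr (f 1%:M).
Proof.
move=> hP; have -> : 1%:M = \sum_i delta_mx i i :> 'M[R[i]]_n.
  rewrite [LHS]matrix_sum_delta; apply: eq_bigr => i _.
  rewrite (bigD1 i) //= big1 ?addr0 => [|j nij]; first by rewrite mxE eqxx scale1r.
  by rewrite mxE eq_sym (negPf nij) scale0r.
rewrite linear_sum raddf_sum mulr_sumr exchange_big; apply: eq_bigr => i _ /=.
rewrite exchange_big (bigD1 i) //= [X in _ + X]big1 ?addr0 => [|j nij].
  by rewrite hs_basis_twirl // eqxx mulr1.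
by rewrite hs_basis_twirl // eq_sym (negPf nij) mulr0 mul0r.
Qed.

(** The form is the entry sum of the Schur product of two matrices, those of the Choi operators of
    [f] and [g] in the families [P] and [Q]. Both are positive, with traces [n] times [\tr (f 1)]
    and [n] times [\tr (g 1)]. *)
Lemma choi_form_product_bounds (R : realType) (n : nat)
    (P Q : 'I_(n * n) -> 'M[R[i]]_n) (f g : supermap R n n) :
  hs_basis P -> hs_basis Q -> completely_positive f -> completely_positive g ->
  0 <= choi_form (\sum_k P k *t Q k) (\sum_k P k *t Q k) (supertens f g)
    <= n%:R ^+ 2 * \tr (supertens f g 1%:M).
Proof.
move=> hP hQ f0 g0.
pose gram (K : 'I_(n * n) -> 'M[R[i]]_n) h : 'M[R[i]]_(n * n) :=
  \matrix_(k, l) choi_form (K k) (K l) h.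
have gram0 K h : completely_positive h -> psdmx (gram K h).
  move=> h0 v; have := choi_form_ge0 (\sum_k v k 0 *: K k) h0.
  rewrite choi_form_suml; congr (0 <= _); rewrite -mulmxA [RHS]mxE.
  apply: eq_bigr => k _; rewrite !mxE choi_form_sumr; congr (_ * _).
  by apply: eq_bigr => l _; rewrite !mxE mulrC.
have trE K h : hs_basis K -> \tr (gram K h) = n%:R * \tr (h 1%:M).
  move=> hK; rewrite -(sum_choi_form_basis h hK).
  by apply: eq_bigr => k _; rewrite mxE.
have := psdmx_schur_bounds (gram0 P f f0) (gram0 Q g g0).
rewrite !trE // mulrACA.
have -> : \tr (f 1%:M) * \tr (g 1%:M) = \tr (supertens f g 1%:M).
  by rewrite -mxtrace_tens -supertensE tensmx11.
rewrite -expr2; suff -> : choi_form (\sum_k P k *t Q k) (\sum_k P k *t Q k)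
  (supertens f g) = \sum_k \sum_l gram P f k l * gram Q g k l by [].
(* Unit coefficients bring the sum into the shape of the sesquilinearity lemmas. *)
have E1 (K : 'I_(n * n) -> 'M[R[i]]_(n * n)) : \sum_k K k = \sum_k 1 *: K k.
  by apply: eq_bigr => k _; rewrite scale1r.
rewrite E1 choi_form_suml; apply: eq_bigr => k _.
rewrite choi_form_sumr conjC1 mul1r; apply: eq_bigr => l _.
by rewrite mul1r choi_form_tens !mxE.
Qed.

(** * Separability of LOCC protocols and the bound on the witness *)

Lemma cptp_tr (R : realType) (m n : nat) (f : supermap R m n) X :
  cptp f -> \tr (f X) = \tr X.
Proof. by case. Qed.

Definition product_cp (R : realType) (m n p q : nat)
    (h : supermap R (m * p) (n * q)) : Prop :=
  exists (f : supermap R m n) (g : supermap R p q),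
    [/\ completely_positive f, completely_positive g & h = supertens f g].

Lemma product_cp_comp (R : realType) (m n p m' n' p' : nat)
    (h : supermap R (n * n') (p * p')) (h' : supermap R (m * m') (n * n')) :
  product_cp h -> product_cp h' -> product_cp (h \o h')%VF.
Proof.
move=> [f [g [f0 g0 ->]]] [f' [g' [f'0 g'0 ->]]].
by exists (f \o f')%VF, (g \o g')%VF; rewrite supertens_comp;
  split=> //; exact: completely_positive_comp.
Qed.

Lemma trace_preserving_tens (R : realType) (m p n : nat)
    (f : supermap R (m * p) n) :
  (forall X Y, \tr (f (X *t Y)) = \tr X * \tr Y) -> trace_preserving f.
Proof.
move=> fT X; rewrite [X]matrix_sum_delta linear_sum !raddf_sum.
apply: eq_bigr => r _ /=; rewrite linear_sum !raddf_sum.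
apply: eq_bigr => s _ /=; rewrite linearZ !mxtraceZ; congr (_ * _).
case: (mxtens_indexP r) => i k; case: (mxtens_indexP s) => j l.
by rewrite -tensmx_delta fT mxtrace_tens.
Qed.

(** Each [T i] preserves the trace, so on product operators the total trace depends only on the sum
    of the [E i]. *)
Lemma one_way_separable (R : realType) (dA dB eA eB : nat) (I : finType)
    (F : I -> supermap R (dA * dB) (eA * eB)) :
  one_way_from_A F \/ one_way_from_B F ->
  (forall i, product_cp (F i)) /\ trace_preserving (\sum_i F i).
Proof.
case=> [[E [T [[E0 ET] T0 FE]]]|[T [E [[E0 ET] T0 FE]]]].
- split=> [i|]; first by exists (E i), (T i); split=> //; case: (T0 i).
  apply: trace_preserving_tens => X Y.
  rewrite sum_lfunE raddf_sum -(ET X) sum_lfunE raddf_sum mulr_suml.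
  by apply: eq_bigr => i _; rewrite /= FE supertensE mxtrace_tens (cptp_tr Y (T0 i)).
- split=> [i|]; first by exists (T i), (E i); split=> //; case: (T0 i).
  apply: trace_preserving_tens => X Y.
  rewrite sum_lfunE raddf_sum -(ET Y) sum_lfunE raddf_sum mulr_sumr.
  by apply: eq_bigr => i _; rewrite /= FE supertensE mxtrace_tens (cptp_tr X (T0 i)).
Qed.

(** Induction on the rounds: products compose, and the continuation preserves the trace after every
    outcome. The invariant concerns complete histories, since coarse-graining yields only sums of
    products. *)
Lemma locc_protocol_separable (R : realType) (dA dB eA eB : nat) (I : finType)
    (F : I -> supermap R (dA * dB) (eA * eB)) :
  locc_protocol F ->
  (forall i, product_cp (F i)) /\ trace_preserving (\sum_i F i).
Proof.
elim=> {dA dB I F} [|dA dB cA cB I J F G F1 _ IH].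
  split=> [_|X]; last by rewrite big_const card_unit /= addr0 id_lfunE.
  exists \1%VF, \1%VF.
  split; [exact: completely_positive_id | exact: completely_positive_id |].
  by rewrite [RHS]supertens_id.
have [F0 FT] := one_way_separable F1.
split=> [[i j]|X] /=.
  by apply: product_cp_comp => //; case: (IH i).
rewrite -(FT X) !sum_lfunE !raddf_sum.
(* A history is a first outcome followed by a history of the continuation. *)
transitivity (\sum_i \sum_j \tr (G i j (F i X))).
  rewrite [RHS]sig_big_dep; apply: eq_bigr => -[i j] _ /=.
  by rewrite comp_lfunE.
apply: eq_bigr => i _ /=; have [_ /(_ (F i X)) <-] := IH i.
by rewrite sum_lfunE raddf_sum.
Qed.

(* n ^ 4 times 2 <Omega|J|Omega> - tr J. *)
Definition witness (R : realType) (n : nat) (P Q : 'I_(n * n) -> 'M[R[i]]_n)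
    (h : supermap R (n * n) (n * n)) : R[i] :=
  2 * choi_form (\sum_k P k *t Q k) (\sum_k P k *t Q k) h
    - n%:R ^+ 2 * \tr (h 1%:M).

Section Witness.

Variables (R : realType) (n : nat) (P Q : 'I_(n * n) -> 'M[R[i]]_n).
Hypotheses (hP : hs_basis P) (hQ : hs_basis Q).
Implicit Types h : supermap R (n * n) (n * n).

Lemma witnessD h h' : witness P Q (h + h') = witness P Q h + witness P Q h'.
Proof.
by rewrite /witness choi_formD add_lfunE raddfD /= !mulrDr opprD addrACA.
Qed.

Lemma witnessZ a h : witness P Q (a *: h) = a * witness P Q h.
Proof.
by rewrite /witness choi_formZ scale_lfunE mxtraceZ mulrCA (mulrCA _ a) mulrBr.
Qed.

Lemma witness_sum (I : finType) (a : I -> R[i])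
    (h : I -> supermap R (n * n) (n * n)) :
  witness P Q (\sum_i a i *: h i) = \sum_i a i * witness P Q (h i).
Proof.
have w0 : witness P Q 0 = 0 by rewrite -[X in witness _ _ X](scale0r 0) witnessZ mul0r.
rewrite (big_morph _ witnessD w0).
by apply: eq_bigr => i _; rewrite witnessZ.
Qed.

Lemma witness_product_cp h :
  product_cp h -> `|witness P Q h| <= n%:R ^+ 2 * \tr (h 1%:M).
Proof.
move=> [f [g [f0 g0 ->]]].
have /andP[c0 cT] := choi_form_product_bounds hP hQ f0 g0.
set c := choi_form _ _ _ in c0 cT *; set t := _ * \tr _ in cT *.
have t0 : 0 <= t by exact: le_trans cT.
(* From [0 <= c <= t] follows [- t <= 2 * c - t <= t]. *)
rewrite /witness -/c -/t real_ler_norml; last first.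
  by rewrite realB // ger0_real // mulr_ge0.
rewrite lerBrDl subrr mulr_ge0 ?ler0n //= lerBlDr.
by rewrite -(mulr2n t) -(mulr_natl t 2) ler_pM2l ?ltr0n.
Qed.

Lemma witness_LOCC h : LOCC h -> `|witness P Q h| <= n%:R ^+ 4.
Proof.
move=> [J [E [s [[I [F [c [FL EF]]]] ->]]]].
have [F0 FT] := locc_protocol_separable FL.
(* The sign of a coarse-grained outcome passes to all histories merged into it, so only signed
   products remain. *)
have -> : \sum_j (-1) ^+ s j *: E j = \sum_i (-1) ^+ s (c i) *: F i.
  rewrite [RHS](partition_big c predT) //=; apply: eq_bigr => j _.
  by rewrite EF scaler_sumr; apply: eq_bigr => i /eqP ->.
rewrite witness_sum (le_trans (ler_norm_sum _ _ _)) //.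
(* Trace preservation at the identity, whose trace is [n * n], supplies the second factor
   [n ^+ 2]. *)
have -> : n%:R ^+ 4 = \sum_i n%:R ^+ 2 * \tr (F i 1%:M) :> R[i].
  rewrite -mulr_sumr -raddf_sum -sum_lfunE.
  by have /= -> := FT 1%:M; rewrite mxtrace1 natrM -expr2 -exprD.
by apply: ler_sum => i _; rewrite normrM normrX normrN1 expr1n mul1r witness_product_cp.
Qed.

End Witness.

(** * Local decompositions *)

Lemma instrument_bool (R : realType) (m n : nat) (f g : supermap R m n) :
  completely_positive f -> completely_positive g -> trace_preserving (f + g) ->
  instrument (fun b : bool => if b then f else g).
Proof. by move=> f0 g0 fgT; split=> [[]//|]; rewrite big_bool. Qed.

Lemma locc_protocol_LOCC (R : realType) (dA dB : nat) (I : finType)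
    (F : I -> supermap R (dA * dB) (dA * dB)) (s : I -> bool) :
  locc_protocol F -> LOCC (\sum_i (-1) ^+ s i *: F i).
Proof.
move=> FL; exists I, F, s; split=> //; exists I, F, id; split=> // j.
by rewrite big_pred1_eq.
Qed.

Lemma sum_sign_bool (R : pzRingType) (V : lmodType R) (t : bool -> bool -> V) :
  \sum_a \sum_b (-1) ^+ (a (+) b) *: t a b =
  t true true - t true false - (t false true - t false false).
Proof.
by rewrite big_bool 2!big_bool /= expr0 expr1 2!scale1r 2!scaleN1r opprB (addrC (- _)).
Qed.

(** Two rounds suffice: [A] applies the instrument with branches [fp] and [fm], then [B] the one
    with branches [gp] and [gm]. The exclusive or of the outcomes encodes the product of the two
    signs. *)
Lemma LO_LOCC (R : realType) (dA dB : nat) (h : supermap R (dA * dB) (dA * dB)) :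
  LO h -> LOCC h.
Proof.
move=> [fA [fB [[fp [fm [fp0 fm0 [_ fT] ->]]] [gp [gm [gp0 gm0 [_ gT] ->]]] ->]]].
pose EA b := if b then fp else fm; pose EB b := if b then gp else gm.
pose FA b := supertens (EA b) (\1%VF : supermap R dB dB).
pose FB b := supertens (\1%VF : supermap R dA dA) (EB b).
have FA1 : one_way_from_A FA.
  exists EA, (fun=> \1%VF); split=> [|b|b]; [|exact: cptp_id|by []].
  exact: instrument_bool.
have FB1 : one_way_from_B FB.
  exists (fun=> \1%VF), EB; split=> [|b|b]; [|exact: cptp_id|by []].
  exact: instrument_bool.
have prot := locc_round (or_introl FA1)
  (fun=> locc_round (or_intror FB1) (fun=> locc_stop R dA dB)).
have := locc_protocol_LOCC (fun p => tag p (+) tag (tagged p)) prot.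
set hs := \sum_p _; suff -> : hs = supertens (fp - fm) (gp - gm) by [].
transitivity (\sum_a \sum_b (-1) ^+ (a (+) b) *: supertens (EA a) (EB b)).
  transitivity (\sum_(a : bool) \sum_(q : {_ : bool & unit})
      (-1) ^+ (a (+) tag q) *: supertens (EA a) (EB (tag q))).
    rewrite [RHS]sig_big_dep; apply: eq_bigr => -[a [b []]] _ /=.
    by congr (_ *: _); rewrite comp_lfun1l [LHS]supertens_comp comp_lfun1l comp_lfun1r.
  apply: eq_bigr => a _.
  (* The last component of a history is the single outcome of [locc_stop]. *)
  transitivity (\sum_(b : bool) \sum_(u : unit)
      (-1) ^+ (a (+) b) *: supertens (EA a) (EB b)).
    by rewrite [RHS]sig_big_dep; apply: eq_bigr => -[b []] _.
  by apply: eq_bigr => b _; rewrite big_const card_unit /= addr0.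
rewrite sum_sign_bool [RHS]supertensDl supertensNl supertensDr supertensNr.
by congr (_ - _); rewrite [RHS]supertensDr supertensNr.
Qed.

Lemma decomposition_cost_fin (R : realType) (n : nat)
    (S : supermap R n n -> Prop) (I : finType) (a : I -> R)
    (F : I -> supermap R n n) :
  (0 < #|I|)%N -> (forall i, S (F i)) ->
  decomposition_cost S (\sum_i (a i)%:C *: F i) (\sum_i `|a i|).
Proof.
move=> I0 SF; exists #|I|, (a \o enum_val), (F \o enum_val); split=> //.
- by move=> i; exact: SF.
- rewrite (reindex (@enum_val I I)) //.
  by exists enum_rank => i _; rewrite ?enum_valK ?enum_rankK.
- rewrite (reindex (@enum_val I I)) //.
  by exists enum_rank => i _; rewrite ?enum_valK ?enum_rankK.
Qed.

Lemma decomposition_cost_sub (R : realType) (n : nat)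
    (S S' : supermap R n n -> Prop) E c :
  (forall h, S h -> S' h) -> decomposition_cost S E c -> decomposition_cost S' E c.
Proof.
move=> SS' [m [a [F [m0 SF -> ->]]]].
by exists m, a, F; split=> // i; exact: SS'.
Qed.

(** Weak duality: the witness is linear and bounded on LOCC. *)
Lemma decomposition_cost_witness (R : realType) (n : nat)
    (P Q : 'I_(n * n) -> 'M[R[i]]_n) E c :
  hs_basis P -> hs_basis Q -> decomposition_cost (@LOCC R n n) E c ->
  `|witness P Q E| <= n%:R ^+ 4 * c%:C.
Proof.
move=> hP hQ [m [a [F [_ LF -> ->]]]].
rewrite witness_sum (le_trans (ler_norm_sum _ _ _)) // rmorph_sum mulr_sumr.
apply: ler_sum => i _; rewrite normrM mulrC ler_pM ?normr_ge0 ?witness_LOCC //.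
by rewrite normc_def /= expr0n addr0 sqrtr_sqr.
Qed.

(** The operators [C] (for [c = 1]) and [S] (for [c = 'i]) of the upper bound. *)
Definition cross (R : realType) (n : nat) (c : R[i]) (P Q : 'M[R[i]]_n) :
    supermap R n n :=
  2^-1 *: (c *: sandwich P Q + c^*%R *: sandwich Q P).

Lemma bilinear_scale_comb (F : comPzRingType) (V V' W : lmodType F) (T : V -> V' -> W)
    (h c c' : F) (f f' : V) (g g' : V') :
  (forall x x' y, T (x + x') y = T x y + T x' y) ->
  (forall x y y', T x (y + y') = T x y + T x y') ->
  (forall a x y, T (a *: x) y = a *: T x y) ->
  (forall a x y, T x (a *: y) = a *: T x y) ->
  T (h *: (c *: f + c' *: f')) (h *: (c *: g + c' *: g')) =
  h *: (h *: ((c * c) *: T f g + (c * c') *: T f g'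
    + ((c' * c) *: T f' g + (c' * c') *: T f' g'))).
Proof.
move=> TDl TDr TZl TZr; rewrite TZl TZr TDl !TZl !TDr !TZr.
by rewrite (scalerDr c) (scalerDr c') !(scalerA c) !(scalerA c').
Qed.

Lemma cross_tens (R : realType) (m n : nat) (c : R[i])
    (P P' : 'M[R[i]]_m) (Q Q' : 'M[R[i]]_n) :
  supertens (cross c P P') (cross c Q Q') =
  2^-1 *: (2^-1 *: (
    (c * c) *: sandwich (P *t Q) (P' *t Q')
    + (c * c^*%R) *: sandwich (P *t Q') (P' *t Q)
    + ((c^*%R * c) *: sandwich (P' *t Q) (P *t Q')
    + (c^*%R * c^*%R) *: sandwich (P' *t Q') (P *t Q)))).
Proof.
rewrite -(supertens_sandwich P P' Q Q') -(supertens_sandwich P P' Q' Q).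
rewrite -(supertens_sandwich P' P Q Q') -(supertens_sandwich P' P Q' Q).
exact: (@bilinear_scale_comb _ _ _ _ (@supertens R m m n n) _ _ _ _ _ _ _
  (@supertensDl _ _ _ _ _) (@supertensDr _ _ _ _ _)
  (@supertensZl _ _ _ _ _) (@supertensZr _ _ _ _ _)).
Qed.

Lemma scale_quarter_cross_sub (F : numFieldType) (V : lmodType F) (a b b' d : V) :
  2^-1 *: (2^-1 *: (1 *: a + 1 *: b + (1 *: b' + 1 *: d))) -
    2^-1 *: (2^-1 *: (-1 *: a + 1 *: b + (1 *: b' + -1 *: d))) =
  2^-1 *: (a + d).
Proof.
rewrite !scale1r !scaleN1r -scalerBr; congr (_ *: _).
rewrite -[RHS](scale_half_sub_sub (b + b')).
congr (_ *: _ - _ *: _); first by rewrite (addrC b') addrACA addrC.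
by rewrite (addrC b') addrACA -opprD addrC.
Qed.

(** Passing from [1] to ['i] flips the aligned terms, as ['i] and its conjugate square to [-1], and
    keeps the mixed ones, as ['i] times its conjugate is [1]. The difference cancels the mixed
    terms. *)
Lemma cross_tens_sub (R : realType) (m n : nat)
    (P P' : 'M[R[i]]_m) (Q Q' : 'M[R[i]]_n) :
  supertens (cross 1 P P') (cross 1 Q Q') -
    supertens (cross 'i%R P P') (cross 'i%R Q Q') =
  2^-1 *: (sandwich (P *t Q) (P' *t Q') + sandwich (P' *t Q') (P *t Q)).
Proof.
have ii : ('i%R : R[i]) * 'i%R = -1 by rewrite -expr2 sqrCi.
have ij : ('i%R : R[i]) * ('i%R)^*%R = 1 by rewrite conjCi mulrN ii opprK.
have ji : ('i%R : R[i])^*%R * 'i%R = 1 by rewrite mulrC.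
have jj : ('i%R : R[i])^*%R * ('i%R)^*%R = -1 by rewrite conjCi mulrNN.
rewrite [X in X - _]cross_tens [X in _ - X]cross_tens ii ij ji jj conjC1 mulr1.
exact: scale_quarter_cross_sub.
Qed.

Lemma sandwich_sum (R : realType) (m n : nat) (I : finType) (r : I -> R)
    (T : I -> 'M[R[i]]_(n, m)) :
  sandwich (\sum_k (r k)%:C *: T k) (\sum_k (r k)%:C *: T k) =
  \sum_(p : I * I) (r p.1 * r p.2)%:C *: sandwich (T p.1) (T p.2).
Proof.
rewrite -(pair_bigA _ (fun k l => (r k * r l)%:C *: sandwich (T k) (T l))) /=.
rewrite sandwich_suml; apply: eq_bigr => k _.
rewrite sandwich_sumr; apply: eq_bigr => l _.
have rl : ((r l)%:C)^*%R = (r l)%:C := conjc_real _.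
by rewrite sandwichZl sandwichZr [LHS]scalerA rl rmorphM.
Qed.

(** Swapping the pair preserves the weights, so each term may be averaged with its swapped
    partner. *)
Lemma sum_scale_half_sym (F : numFieldType) (V : lmodType F) (I : finType)
    (c : I * I -> F) (X : I * I -> V) :
  (forall k l, c (k, l) = c (l, k)) ->
  \sum_p c p *: (2^-1 *: (X p + X (p.2, p.1))) = \sum_p c p *: X p.
Proof.
move=> cC; rewrite -[RHS]scale_half_double.
under eq_bigr do rewrite scalerA mulrC -scalerA scalerDr.
rewrite -scaler_sumr big_split /=; congr (_ *: (_ + _)).
rewrite (reindex_inj (h := fun p : I * I => (p.2, p.1))) /=; last first.
  by move=> [? ?] [? ?] [-> ->].
by apply: eq_bigr => -[k l] _ /=; rewrite cC.
Qed.

Lemma sum_pair_diag (R : comPzRingType) (I : finType) (r : I -> R) :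
  \sum_(p : I * I) r p.1 * r p.2 =
  \sum_k r k ^+ 2 + \sum_(p : I * I | p.1 != p.2) r p.1 * r p.2.
Proof.
rewrite (bigID (fun p : I * I => p.1 == p.2)) /=; congr (_ + _).
rewrite -(pair_big_dep xpredT (fun k l : I => k == l) (fun k l => r k * r l)) /=.
by apply: eq_bigr => k _; rewrite (big_pred1 k) // => l; rewrite eq_sym.
Qed.

Lemma cross_self (R : realType) (n : nat) (P : 'M[R[i]]_n) : cross 'i%R P P = 0.
Proof.
by rewrite /cross conjCi scaleNr subrr scaler0.
Qed.

(** * Schmidt decompositions into unitary operator bases *)

Section Schmidt.

Variables (R : realType) (n : nat) (P Q : 'I_(n * n) -> 'M[R[i]]_n).
Variable r : 'I_(n * n) -> R.
Hypotheses (hP : hs_basis P) (hQ : hs_basis Q).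
Hypotheses (UP : forall k, P k \is unitarymx) (UQ : forall k, Q k \is unitarymx).
Hypotheses (r0 : forall k, 0 <= r k) (r1 : \sum_k r k ^+ 2 = 1).

Let U := \sum_k (r k)%:C *: (P k *t Q k).
Let g : R := 1 + 2 * \sum_(p : 'I_(n * n) * 'I_(n * n) | p.1 != p.2) r p.1 * r p.2.

(** For [n = 0] the normalization [r1] would equate an empty sum with 1. *)
Lemma schmidt_dim_gt0 : (0 < n)%N.
Proof.
rewrite lt0n; apply/eqP=> n0.
have /card0_eq I0 : #|'I_(n * n)| = 0%N by rewrite card_ord n0.
by move: r1; rewrite big1 => [/eqP|k _]; [rewrite eq_sym oner_eq0 | have := I0 k].
Qed.

Lemma schmidt_LO_cost : decomposition_cost (@LO R n n) (sandwich U U) g.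
Proof.
pose ph (b : bool) : R[i] := if b then 1 else 'i%R.
have phU b : ph b * (ph b)^*%R = 1.
  by case: b; rewrite /= ?conjC1 ?mulr1 // conjCi mulrN -expr2 sqrCi opprK.
pose J : finType := ('I_(n * n) * 'I_(n * n))%type.
(* The boolean selects the [C] term ([true]) or the [S] term ([false]). The zero on the diagonal,
   where [S] vanishes, lowers the cost from [2 (sum_k r k) ^+ 2] by [sum_k r k ^+ 2 = 1] to [g]. *)
pose a (q : J * bool) := let: (k, l, b) := q in
  if b then r k * r l else if k == l then 0 else - (r k * r l).
pose F (q : J * bool) := let: (k, l, b) := q in
  supertens (cross (ph b) (P k) (P l)) (cross (ph b) (Q k) (Q l)).
have -> : sandwich U U = \sum_q (a q)%:C *: F q.
  transitivity (\sum_p \sum_b (a (p, b))%:C *: F (p, b)); last first.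
    by rewrite pair_bigA; apply: eq_bigr => -[].
  rewrite sandwich_sum.
  rewrite -sum_scale_half_sym => [|k l]; last by rewrite /= mulrC.
  apply: eq_bigr => -[k l] _; rewrite big_bool /=.
  rewrite -cross_tens_sub [LHS]scalerBr; congr (_ + _).
  case: eqP => [->|_]; last by rewrite rmorphN scaleNr.
  by rewrite cross_self supertens0l 2!scaler0 oppr0.
have -> : g = \sum_q `|a q|.
  transitivity (\sum_p \sum_b `|a (p, b)|); last first.
    by rewrite pair_bigA; apply: eq_bigr => -[].
  transitivity (\sum_(p : J) r p.1 * r p.2
      + \sum_(p : J | p.1 != p.2) r p.1 * r p.2).
    by rewrite /g sum_pair_diag r1 -addrA -mulr2n mulr_natl.
  rewrite [X in _ + X]big_mkcond -big_split; apply: eq_bigr => -[k l] _.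
  rewrite big_bool /= ger0_norm ?mulr_ge0 //; congr (_ + _).
  by case: eqP => _; rewrite ?normr0 // normrN ger0_norm ?mulr_ge0.
apply: decomposition_cost_fin => [|[[k l] b]].
  by rewrite 2!card_prod card_bool card_ord !muln_gt0 schmidt_dim_gt0.
by exists (cross (ph b) (P k) (P l)), (cross (ph b) (Q k) (Q l)); split=> //;
  exact: signed_op_cross.
Qed.

(** The Choi operator of the map is [|U>><<U|]. The overlap of [|U>>] with the witness vector is
    [n ^+ 2 * \sum_k r k], and the trace term is the squared norm [n ^+ 2] of [U]. *)
Lemma schmidt_witness : witness P Q (sandwich U U) = n%:R ^+ 4 * g%:C.
Proof.
have T k l : \tr ((P k *t Q k) ^t* *m (P l *t Q l)) = n%:R ^+ 2 * (k == l)%:R.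
  rewrite adjmx_tens tensmx_mul mxtrace_tens hP hQ mulrACA -expr2.
  by rewrite -natrM mulnb andbb.
(* Parseval for the [P k *t Q k]: coefficients [r] give [U], and unit coefficients give the witness
   vector. *)
have comb (a b : 'I_(n * n) -> R) :
    \tr ((\sum_k (a k)%:C *: (P k *t Q k)) ^t* *m (\sum_k (b k)%:C *: (P k *t Q k)))
    = n%:R ^+ 2 * (\sum_k a k * b k)%:C.
  rewrite adjmx_sum mulmx_suml raddf_sum rmorph_sum mulr_sumr.
  apply: eq_bigr => k _; rewrite mulmx_sumr raddf_sum /= (bigD1 k) //= big1.
    rewrite addr0 adjmxZ -scalemxAl -scalemxAr !mxtraceZ T eqxx mulr1.
    have -> : ((a k)%:C)^*%R = (a k)%:C := conjc_real _.
    by rewrite rmorphM mulrA mulrC.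
  move=> l nl; rewrite adjmxZ -scalemxAl -scalemxAr !mxtraceZ T eq_sym (negPf nl).
  by rewrite !mulr0.
have ME : \sum_k P k *t Q k = \sum_k ((1 : R)%:C) *: (P k *t Q k).
  by apply: eq_bigr => k _; rewrite rmorph1 scale1r.
rewrite /witness choi_form_sandwich ME !comb sandwichE mulmx1 mxtrace_mulC comb.
under eq_bigr do rewrite mul1r.
under [\sum_k r k * 1]eq_bigr do rewrite mulr1.
have -> : \sum_k r k * r k = 1 by rewrite -[RHS]r1.
have ss : (\sum_k r k)%:C * (\sum_k r k)%:C =
    1 + (\sum_(p : 'I_(n * n) * 'I_(n * n) | p.1 != p.2) r p.1 * r p.2)%:C :> R[i].
  rewrite -rmorphM big_distrlr /= pair_bigA sum_pair_diag r1.
  by rewrite rmorphD rmorph1.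
rewrite /g rmorph1 rmorphD rmorphM rmorph1 rmorph_nat.
transitivity (n%:R ^+ 4 * (2 * ((\sum_k r k)%:C * (\sum_k r k)%:C) - 1) : R[i]).
  by ring.
by rewrite ss; ring.
Qed.

(** LO is contained in LOCC, so the upper bound for LO and the lower bound for LOCC settle both
    equalities. *)
Lemma schmidt_gamma :
  is_gamma (@LO R n n) (sandwich U U) g /\ is_gamma (@LOCC R n n) (sandwich U U) g.
Proof.
have lower c : decomposition_cost (@LOCC R n n) (sandwich U U) c -> g <= c.
  move=> /(decomposition_cost_witness hP hQ); rewrite schmidt_witness normrM.
  have n0 : 0 < n%:R ^+ 4 :> R[i].
    by rewrite exprn_gt0 // ltr0n schmidt_dim_gt0.
  rewrite (gtr0_norm n0) ler_pM2l // -lecR; apply: le_trans.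
  by apply: real_ler_norm; apply/complex_realP; exists g.
have upper := schmidt_LO_cost.
split; split=> //; last exact: decomposition_cost_sub (@LO_LOCC R n n) upper.
by move=> c /(decomposition_cost_sub (@LO_LOCC R n n)) /lower.
Qed.

End Schmidt.

(** * Two-qubit unitaries *)

(** Sixteen traces, each compared in real and imaginary part; ['I_4] and ['I_(2 * 2)] agree by
    conversion. *)
Lemma pauli_hs_basis (R : realType) : @hs_basis R 2 (pauli R).
Proof.
move=> k l.
case: k => [[|[|[|[|//]]]] hk]; case: l => [[|[|[|[|//]]]] hl];
  rewrite /mxtrace !big_ord_recl !big_ord0 !mxE !big_ord_recl !big_ord0 !mxE /=;
  by apply/eqP; rewrite eq_complex /=; apply/andP; split; apply/eqP; ring.
Qed.

Lemma pauli_unitary (R : realType) (k : 'I_4) : pauli R k \is unitarymx.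
Proof.
apply/unitarymxP/matrixP=> i j.
case: k => [[|[|[|[|//]]]] hk]; case: i => [[|[|//]] hi]; case: j => [[|[|//]] hj];
  rewrite !mxE !big_ord_recl !big_ord0 !mxE /=;
  by apply/eqP; rewrite eq_complex /=; apply/andP; split; apply/eqP; ring.
Qed.

(** Both unitaries cancel inside the trace, [W] after a cyclic permutation. *)
Lemma hs_basis_congr (R : realType) (n : nat) (P : 'I_(n * n) -> 'M[R[i]]_n)
    (V W : 'M[R[i]]_n) :
  V \is unitarymx -> W \is unitarymx ->
  hs_basis P -> hs_basis (fun k => V *m P k *m W).
Proof.
move=> /unitarymxP/mulmx1C UV /unitarymxP UW hP k l; rewrite -hP !adjmx_mul.
by rewrite !mulmxA mxtrace_mulC !mulmxA UW mul1mx -!mulmxA (mulmxA (V ^t*)) UV mul1mx.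
Qed.

Lemma hs_basis_scale (R : realType) (n : nat) (P : 'I_(n * n) -> 'M[R[i]]_n)
    (c : 'I_(n * n) -> R[i]) :
  (forall k, c k * (c k)^*%R = 1) -> hs_basis P -> hs_basis (fun k => c k *: P k).
Proof.
move=> cc hP k l; rewrite adjmxZ -scalemxAl -scalemxAr scalerA mxtraceZ hP.
by case: eqP => [->|_]; rewrite ?mulr0 // (mulrC _ (c l)) cc mul1r.
Qed.

Lemma scale_unitarymx (R : realType) (m n : nat) (c : R[i]) (V : 'M[R[i]]_(m, n)) :
  c * c^*%R = 1 -> V \is unitarymx -> c *: V \is unitarymx.
Proof.
move=> cc /unitarymxP VV; apply/unitarymxP.
by rewrite adjmxZ -scalemxAl -scalemxAr scalerA cc scale1r.
Qed.

Lemma normr_normc (R : realType) (z : R[i]) : `|z| = (normc z)%:C.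
Proof. by []. Qed.

Lemma phase_exists (R : realType) (z : R[i]) :
  exists c : R[i], c * c^*%R = 1 /\ z = (normc z)%:C * c.
Proof.
have [->|z0] := eqVneq z 0.
  (* Zero has no phase of its own; [1] is chosen. *)
  by exists 1; rewrite conjC1 mulr1 -normr_normc normr0 mul0r.
exists (z / `|z|); rewrite -normr_normc mulrCA divff ?normr_eq0 // mulr1; split=> //.
by rewrite -normCK normf_div normr_id divff ?normr_eq0 // expr1n.
Qed.

Theorem corollary3p1 (R : realType) (U : 'M[R[i]]_(2 * 2)) (u : 'I_4 -> R[i])
    (hU : U \is unitarymx) (hu : kak_parameters U u) :
  let g : R := 1 + 2 * \sum_(p : 'I_4 * 'I_4 | p.1 != p.2)
                         normc (u p.1) * normc (u p.2) in
  is_gamma (@LO R 2 2) (unitary_channel U) g /\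
  is_gamma (@LOCC R 2 2) (unitary_channel U) g.
Proof.
case: hu => u1 [V1 [V2 [V3 [V4 [UV1 UV2 UV3 UV4 UE]]]]] g.
have [c cE] := fin_all_exists (fun k => phase_exists (u k)).
(* Moving the phases [c k] into [Q] leaves the nonnegative Schmidt coefficients [normc (u k)]. *)
pose P k := V1 *m pauli R k *m V3; pose Q k := c k *: (V2 *m pauli R k *m V4).
have -> : U = \sum_k (normc (u k))%:C *: (P k *t Q k).
  rewrite UE mulmx_sumr mulmx_suml; apply: eq_bigr => k _.
  rewrite -scalemxAr -scalemxAl 2!tensmx_mul tensmxZr scalerA.
  by have [_ <-] := cE k.
have hP : @hs_basis R 2 P by exact: hs_basis_congr (@pauli_hs_basis R).
have hQ : @hs_basis R 2 Q.
  apply: hs_basis_scale => [k|]; first by case: (cE k).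
  exact: hs_basis_congr (@pauli_hs_basis R).
have UP k : P k \is unitarymx.
  exact: mul_unitarymx (mul_unitarymx UV1 (pauli_unitary R k)) UV3.
have UQ k : Q k \is unitarymx.
  apply: scale_unitarymx; first by case: (cE k).
  exact: mul_unitarymx (mul_unitarymx UV2 (pauli_unitary R k)) UV4.
have u0 k : 0 <= normc (u k) by rewrite -lecR -normr_normc normr_ge0.
(* [unitary_channel] of the sum and the corresponding [sandwich] are convertible. *)
exact: (schmidt_gamma hP hQ UP UQ u0 u1).
Qed.
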